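(* Let $n\ge3$ and let $h_1,\dots,h_n$ be real constants, with $h=\mathrm{diag}(h_1,\dots,h_n)$, satisfying $$2h_1=-\sum_{i=3}^{n-1}h_i,\qquad (\mathrm{tr}\,h)^2-\mathrm{tr}(h^2)=\frac12.$$ Consider the vacuum solution $$ds^2=\cosh(t)\left(-e^{2(\mathrm{tr}\,h)t}dt^2+e^{2h_2t}dx_2^2+e^{2h_nt}dx_n^2\right)+\frac{e^{2h_1t}}{\cosh t}(dx_1-x_n\,dx_2)^2+\sum_{i=3}^{n-1}e^{2h_it}dx_i^2,$$ with scale factors $$a_1=e^{h_1t}(\cosh t)^{-1/2},\quad a_2=e^{h_2t}(\cosh t)^{1/2},\quad a_i=e^{h_it}\ (3\le i\le n-1),\quad a_n=e^{h_nt}(\cosh t)^{1/2}.$$ Let $H_i=\dot a_i/a_i$ and $H_i(\infty)=\lim_{t\to\infty}H_i(t)$ for $1\le i\le n$. Then the numbers $H_1(\infty),\dots,H_n(\infty)$ cannot be all positive, and they cannot be all negative.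
   Context: A dot denotes $d/dt$. For $n=3$ the sum $\sum_{i=3}^{n-1}$ is zero. *)

(* Defs.v *)
From HB Require Import structures.
From mathcomp Require Import all_boot all_order all_algebra.
From mathcomp Require Import all_classical all_reals all_analysis.
From mathcomp Require Import ring.

Set Implicit Arguments.
Unset Strict Implicit.
Unset Printing Implicit Defensive.

Import Order.TTheory GRing.Theory Num.Theory.
Import numFieldNormedType.Exports.

Local Open Scope ring_scope.
Local Open Scope classical_set_scope.

(* The constants h_1, ..., h_n are given by h : nat -> R with 1-based indices;
   the values of h outside {1, ..., n} are irrelevant. *)

Section VacuumSolution.
Context {R : realType}.
Implicit Types (n i : nat) (h : nat -> R) (t : R).

Definition cosh t : R := (expR t + expR (- t)) / 2.

Definition hmx n h : 'M[R]_n := diag_mx (\row_(i < n) h i.+1).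

Definition scale_factor n h i t : R :=
  if i == 1%N then expR (h 1%N * t) * cosh t `^ (- 2^-1)
  else if (i == 2%N) || (i == n) then expR (h i * t) * cosh t `^ 2^-1
  else expR (h i * t).

Definition H n h i : R -> R :=
  fun t => ((scale_factor n h i)^`())%classic t / scale_factor n h i t.

Definition H_infty n h i : R := lim (H n h i t @[t --> +oo%R]).

(* The line element at time t and spatial position x, as a quadratic form in
   the components v of a tangent vector: v 0 is dt and v i is dx_i. *)
Definition line_element n h t (x v : nat -> R) : R :=
  cosh t * (- expR (2 * \tr (hmx n h) * t) * v 0%N ^+ 2
            + expR (2 * h 2%N * t) * v 2%N ^+ 2
            + expR (2 * h n * t) * v n ^+ 2)
  + expR (2 * h 1%N * t) / cosh t * (v 1%N - x n * v 2%N) ^+ 2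
  + \sum_(3 <= i < n) expR (2 * h i * t) * v i ^+ 2.

Definition coframe n (x v : nat -> R) i : R :=
  if i == 1%N then v 1%N - x n * v 2%N else v i.

Lemma cosh_gt0 t : 0 < cosh t.
Proof. by rewrite /cosh divr_gt0// addr_gt0// expR_gt0. Qed.

Lemma line_elementE n h t x v : (3 <= n)%N ->
  line_element n h t x v =
    - (cosh t * expR (2 * \tr (hmx n h) * t)) * v 0%N ^+ 2
    + \sum_(1 <= i < n.+1) scale_factor n h i t ^+ 2 * coframe n x v i ^+ 2.
Proof.
move=> n3.
have expR2 (c : R) : expR (c * t) ^+ 2 = expR (2 * c * t).
  by rewrite -expRM_natl mulrA.
have sqrt2 : (cosh t `^ 2^-1) ^+ 2 = cosh t.
  by rewrite powR12_sqrt ?sqr_sqrtr// ltW// cosh_gt0.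
rewrite big_nat_recr /=; last by rewrite (leq_trans _ n3).
rewrite big_ltn; last by rewrite (leq_trans _ n3).
rewrite big_ltn; last by rewrite (leq_trans _ n3).
have n1 : (n == 1)%N = false by case: n n3 => [|[|]].
rewrite /scale_factor /coframe /= n1 eqxx orbT !exprMn !expR2 sqrt2.
rewrite powRN exprVn sqrt2 /line_element.
have -> : \sum_(3 <= i < n)
    (if i == 1%N then expR (h 1%N * t) * (cosh t `^ 2^-1)^-1
     else if (i == 2%N) || (i == n) then expR (h i * t) * cosh t `^ 2^-1
     else expR (h i * t)) ^+ 2
    * (if i == 1%N then v 1%N - x n * v 2%N else v i) ^+ 2
  = \sum_(3 <= i < n) expR (2 * h i * t) * v i ^+ 2.
  apply: eq_big_nat => i /andP[i3 iltn].
  have -> : (i == 1)%N = false by case: i i3 {iltn} => [|[|]].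
  have -> : (i == 2)%N = false by case: i i3 {iltn} => [|[|[|]]].
  by rewrite (ltn_eqF iltn) /= expR2.
set S := \sum_(3 <= i < n) _.
ring.
Qed.

End VacuumSolution.

(* Main.v *)
(* Each scale factor is e^{h_i t} (cosh t)^{p_i} with p_1 = -1/2,
   p_2 = p_n = 1/2 and p_i = 0 otherwise, so H_i = h_i + p_i tanh t tends to
   h_i + p_i.  If all limits were positive, then h_1 > 1/2, whereas
   2 h_1 = - sum_{3 <= i < n} h_i <= 0.  If all were negative, put a = - h_2 and
   b = - h_n, both > 1/2, x = h_1 and Q = sum_{3 <= i < n} h_i^2.  Then
   0 <= x < 1/2 and, the h_i having the same sign,
   Q <= (sum_{3 <= i < n} h_i)^2 = 4 x^2.  The quadratic constraint would read
   1/2 = 2ab + 2x(a + b) - Q > 1/2 + 2x - 4x^2 >= 1/2. *)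
Require Import Defs.
From HB Require Import structures.
From mathcomp Require Import all_boot all_order all_algebra.
From mathcomp Require Import all_classical all_reals all_analysis.
From mathcomp Require Import ring lra.

Set Implicit Arguments.
Unset Strict Implicit.
Unset Printing Implicit Defensive.

Import Order.TTheory GRing.Theory Num.Theory.
Import numFieldNormedType.Exports.

Local Open Scope ring_scope.
Local Open Scope classical_set_scope.

Section Asymptotics.
Context {R : realType}.
Implicit Types (n i : nat) (h : nat -> R) (t : R).

Definition cosh_exponent n i : R :=
  if i == 1%N then - 2^-1 else if (i == 2%N) || (i == n) then 2^-1 else 0.

(** With a single exponential, the logarithmic derivative [H] is just the derivative of the
    exponent. *)
Lemma scale_factorE n h i t :
  scale_factor n h i t = expR (h i * t + cosh_exponent n i * ln (cosh t)).
Proof.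
have c0 : cosh t != 0 by rewrite gt_eqF// cosh_gt0.
rewrite /scale_factor /cosh_exponent expRD /powR (negbTE c0).
case: (i =P 1%N) => [->//|_].
case: (_ || _) => //.
by rewrite mul0r expR0 mulr1.
Qed.

Lemma is_derive_cosh t : is_derive t 1 cosh ((expR t - expR (- t)) / 2).
Proof.
have -> : @cosh R = 2^-1 \*: (expR + (expR \o -%R)).
  by apply/funext => u; rewrite /cosh mulrC.
have dN : is_derive t 1 (expR \o -%R) (expR (- t) * - 1).
  exact: is_derive1_comp.
by apply: is_derive_eq; rewrite /= mulrN1 mulrC.
Qed.

Lemma HE n h i t :
  H n h i t =
  h i + cosh_exponent n i * ((expR t - expR (- t)) / (expR t + expR (- t))).
Proof.
rewrite /H; set p := cosh_exponent n i.
set g := fun u => h i * u + p * ln (cosh u).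
have -> : scale_factor n h i = expR \o g.
  by apply/funext => u; rewrite scale_factorE.
have c0 := cosh_gt0 t.
have dl : is_derive t 1 (@ln R \o cosh)
    ((cosh t)^-1 * ((expR t - expR (- t)) / 2)).
  by apply: is_derive1_comp; [exact: is_derive1_ln | exact: is_derive_cosh].
have dg : is_derive t 1 g
    (h i + p * ((cosh t)^-1 * ((expR t - expR (- t)) / 2))).
  have -> : g = h i \*: (@id R) + p \*: (@ln R \o cosh) by [].
  by apply: is_derive_eq; rewrite /GRing.scale /= mulr1.
have de : is_derive t 1 (expR \o g)
    (expR (g t) * (h i + p * ((cosh t)^-1 * ((expR t - expR (- t)) / 2)))).
  exact: is_derive1_comp.
rewrite derive1E derive_val /= mulrAC divff ?gt_eqF ?expR_gt0// mul1r /cosh.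
have s0 : 0 < expR t + expR (- t) by rewrite addr_gt0 ?expR_gt0.
by congr (_ + _ * _); field; rewrite gt_eqF.
Qed.

Lemma cvg_tanh :
  (expR t - expR (- t)) / (expR t + expR (- t)) @[t --> +oo%R] --> (1 : R).
Proof.
(* Dividing through by [expR t] leaves only powers of [expR (- t)], which tend to 0. *)
have -> : (fun t => (expR t - expR (- t)) / (expR t + expR (- t))) =
    (fun t => (1 - expR (- t) * expR (- t)) / (1 + expR (- t) * expR (- t))).
  apply/funext => t; have e0 := expR_gt0 (- t).
  have -> : expR t = (expR (- t))^-1 by rewrite expRN invrK.
  set u := expR (- t).
  by field; rewrite !gt_eqF ?addr_gt0 ?mulr_gt0.
have e2 : expR (- t) * expR (- t) @[t --> +oo%R] --> (0 * 0 : R).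
  by apply: cvgM; exact: cvgr_expR.
rewrite mulr0 in e2.
have c1 : (fun=> 1) (t : R) @[t --> +oo%R] --> (1 : R) by exact: cvg_cst.
rewrite -[X in _ --> X](_ : (1 - 0) / (1 + 0) = _); last first.
  by rewrite subr0 addr0 divr1.
apply: cvgM; first exact: cvgB c1 e2.
by apply: cvgV; [rewrite addr0 oner_eq0 | exact: cvgD c1 e2].
Qed.

Lemma H_cvg n h i : H n h i t @[t --> +oo%R] --> h i + cosh_exponent n i.
Proof.
under eq_fun do rewrite HE.
apply: cvgD; first exact: cvg_cst.
rewrite -[X in _ --> X]mulr1.
by apply: cvgM; [exact: cvg_cst | exact: cvg_tanh].
Qed.

Lemma H_inftyE n h i : H_infty n h i = h i + cosh_exponent n i.
Proof. exact/cvg_lim/H_cvg. Qed.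

End Asymptotics.

(** Isolates the indices 1, 2 and n, the only ones with a nonzero [cosh_exponent]; for n = 3 the
    middle sum is empty. *)
Lemma sum_split_ends (V : nmodType) (n : nat) (F : nat -> V) : (3 <= n)%N ->
  \sum_(i < n) F i.+1 = F 1%N + (F 2%N + (\sum_(3 <= i < n) F i + F n)).
Proof.
case: n => [|[|[|n]]]// _.
rewrite -(big_mkord xpredT (fun i => F i.+1)) -(big_add1 _ _ 0 n.+4 xpredT F).
by rewrite big_ltn// big_ltn// big_nat_recr.
Qed.

(** Expanding the square of the sum adds cross products of nonpositive terms, which are
    nonnegative. *)
Lemma sum_sqr_le_sqr_sum (R : realDomainType) (I : Type) (r : seq I)
    (P : pred I) (F : I -> R) : (forall i, P i -> F i <= 0) ->
  \sum_(i <- r | P i) F i ^+ 2 <= (\sum_(i <- r | P i) F i) ^+ 2.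
Proof.
move=> F0.
(* The induction must carry the sign of the partial sums as well, to get [0 <= s1 * s2]. *)
suff [] : \sum_(i <- r | P i) F i ^+ 2 <= (\sum_(i <- r | P i) F i) ^+ 2 /\
    \sum_(i <- r | P i) F i <= 0 by [].
apply: (big_ind2 (fun q s => q <= s ^+ 2 /\ s <= 0)).
- by rewrite expr0n.
- by move=> q1 s1 q2 s2 [? ?] [? ?]; split; nra.
- by move=> i Pi; split => //; exact: F0.
Qed.

Lemma tr_hmx (R : realType) (n : nat) (h : nat -> R) :
  \tr (hmx n h) = \sum_(i < n) h i.+1.
Proof. by rewrite mxtrace_diag; apply: eq_bigr => i _; rewrite mxE. Qed.

Lemma tr_hmx_sqr (R : realType) (n : nat) (h : nat -> R) :
  \tr (hmx n h *m hmx n h) = \sum_(i < n) h i.+1 ^+ 2.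
Proof.
by rewrite mulmx_diag mxtrace_diag; apply: eq_bigr => i _; rewrite !mxE expr2.
Qed.

Theorem proposition5p1 (R : realType) (n : nat) (h : nat -> R)
    (n3 : (3 <= n)%N)
    (h1E : 2 * h 1%N = - \sum_(3 <= i < n) h i)
    (trE : (\tr (hmx n h)) ^+ 2 - \tr (hmx n h *m hmx n h) = 2^-1) :
  [/\ forall i, (1 <= i <= n)%N -> cvg (H n h i t @[t --> +oo%R]),
      ~ (forall i, (1 <= i <= n)%N -> 0 < H_infty n h i)
    & ~ (forall i, (1 <= i <= n)%N -> H_infty n h i < 0)].
Proof.
have n1 : (1 <= n)%N by rewrite (leq_trans _ n3).
have nE1 : (n == 1)%N = false by case: n n3 {h1E trE n1} => [|[|]].
have mid i : (3 <= i < n)%N ->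
    (1 <= i <= n)%N /\ cosh_exponent n i = 0 :> R.
  case/andP=> i3 ltin; rewrite (leq_trans _ i3)// (ltnW ltin); split=> //.
  rewrite /cosh_exponent (ltn_eqF ltin) orbF.
  by case: i i3 {ltin} => [|[|[|]]].
split=> [i _|pos|neg].
(* Convergence ensures that [H_infty] is a genuine limit and not the default value of [lim]. *)
- by apply/cvg_ex; eexists; exact: H_cvg.
- have := pos 1%N; rewrite n1 H_inftyE /cosh_exponent /= => /(_ isT) h1.
  have : 0 <= \sum_(3 <= i < n) h i.
    rewrite big_nat; apply: sumr_ge0 => i /mid[/pos + p0].
    by rewrite H_inftyE p0 addr0 => /ltW.
  lra.
- have := neg 1%N; rewrite n1 H_inftyE /cosh_exponent /= => /(_ isT) h1.
  have := neg 2%N; rewrite (leq_trans _ n3)// H_inftyE /cosh_exponent /=.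
  move=> /(_ isT) h2.
  have := neg n; rewrite n1 leqnn H_inftyE /cosh_exponent nE1 eqxx orbT.
  move=> /(_ isT) hn.
  have hmid i : (3 <= i < n)%N -> h i <= 0.
    by move=> /mid[/neg + p0]; rewrite H_inftyE p0 addr0 => /ltW.
  have S0 : \sum_(3 <= i < n) h i <= 0.
    by rewrite big_nat; apply: sumr_le0.
  have QS : \sum_(3 <= i < n) h i ^+ 2 <= (\sum_(3 <= i < n) h i) ^+ 2.
    (* [big_nat] moves the range into the predicate, where [hmid] gives the sign. *)
    by rewrite big_nat [X in _ <= X ^+ 2]big_nat; exact: sum_sqr_le_sqr_sum.
  move: trE; rewrite tr_hmx tr_hmx_sqr sum_split_ends//.
  rewrite (sum_split_ends (fun i => h i ^+ 2))//.
  move: h1E S0 QS; set S := \sum_(_ <= _ < _) _; set Q := \sum_(_ <= _ < _) _.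
  move=> SE S0 QS trE.
  have ab : 4^-1 < h 2%N * h n by nra.
  (* Here [0 <= h 1] since [2 * h 1 = - S], while [h 2] and [h n] are below -1/2; the next bound
     uses [h 1 < 1/2]. *)
  have xab : 0 <= h 1%N * (- h 2%N - h n - 1) by apply: mulr_ge0; lra.
  have xx : 0 <= h 1%N * (1 - 2 * h 1%N) by apply: mulr_ge0; lra.
  have SS : S ^+ 2 = 4 * h 1%N ^+ 2.
    by rewrite -[S]opprK -SE; ring.
  have SE' : S = - (2 * h 1%N) by lra.
  (* Twice the sum of [ab], [xab] and [xx], added to [QS], contradicts [trE]. *)
  move: trE QS; rewrite SS SE'; nra.
Qed.
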